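(* Let $\delta t>0$ and suppose that $(\phi^n,r^n)$ and $(\phi^{n+1},\mu^{n+1},r^{n+1})$ satisfy the first-order scheme $$\frac{\phi^{n+1}-\phi^n}{\delta t}=-\mathcal{G}\mu^{n+1},$$ $$\mu^{n+1}=\mathcal{L}\phi^{n+1}+\frac{r^{n+1}}{G\left(\int_{\Omega}F(\phi^n)\,dx\right)}F'(\phi^n),$$ $$\frac{G^{-1}(r^{n+1})-G^{-1}(r^n)}{\delta t}=\frac{r^{n+1}}{G\left(\int_{\Omega}F(\phi^n)\,dx\right)}\left(F'(\phi^n),\frac{\phi^{n+1}-\phi^n}{\delta t}\right).$$ Then the scheme is unconditionally energy stable, in the sense that (for every $\delta t>0$) $$\tilde E^{n+1}-\tilde E^{n}\le -\delta t\,(\mathcal{G}\mu^{n+1},\mu^{n+1}),$$ where $\tilde E^k=\int_\Omega \frac12\,\mathcal{L}\phi^k\cdot\phi^k\,dx+G^{-1}(r^k)$.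
   Context: $\Omega$ is a bounded spatial domain, $(\cdot,\cdot)$ is the $L^2(\Omega)$ inner product. $\mathcal{L}$ is a linear, self-adjoint, positive operator (so $(\mathcal{L}u,v)=(u,\mathcal{L}v)$ and $(\mathcal{L}u,u)\ge 0$); $\mathcal{G}$ is a positive operator ($(\mathcal{G}u,u)\ge 0$). $F$ is a nonlinear potential and $F'(\phi)$ its (variational) derivative. $G$ is an invertible scalar function with inverse $G^{-1}$ (not to be confused with the operator $\mathcal{G}$). The unknowns $\phi^k,\mu^k$ are real-valued functions on $\Omega$, regular enough that all expressions make sense, satisfying either periodic boundary conditions or homogeneous Neumann conditions $\partial_{\mathbf n}\phi=\partial_{\mathbf n}\mu=0$ on $\partial\Omega$; the $r^k$ are real scalars in the domain of $G^{-1}$; it is understood that $G(\int_\Omega F(\phi^n)\,dx)$ is defined and nonzero. The scheme discretizes the gradient flow $\phi_t=-\mathcal{G}\mu$, $\mu=\mathcal{L}\phi+F'(\phi)$ using the scalar auxiliary variable $r=G(\int_\Omega F(\phi)\,dx)$. *)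

(* Defs.v *)
From HB Require Import structures.
From mathcomp Require Import all_boot all_order all_algebra.
From mathcomp Require Import all_classical all_reals all_analysis.
Set Implicit Arguments.
Unset Strict Implicit.
Unset Printing Implicit Defensive.
Import Order.TTheory GRing.Theory Num.Theory.
Import numFieldNormedType.Exports.
Local Open Scope classical_set_scope.
Local Open Scope ring_scope.

Section pushforward_cancel.
Context d1 d2 (T1 : measurableType d1) (T2 : measurableType d2) (R : realType).
Variables (m : {sigma_finite_measure set T1 -> \bar R}).
Variables (f : T1 -> T2) (g : T2 -> T1).

Definition pushforward_cancel (mf : measurable_fun setT f)
  (mg : measurable_fun setT g) (fK : cancel f g) : set T2 -> \bar R :=
  pushforward m f.

Hypotheses (mf : measurable_fun setT f) (mg : measurable_fun setT g).
Hypothesis fK : cancel f g.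

Let pc0 : pushforward_cancel mf mg fK set0 = 0%E.
Proof. by rewrite /pushforward_cancel /pushforward preimage_set0 measure0. Qed.

Let pc_ge0 A : (0 <= pushforward_cancel mf mg fK A)%E.
Proof. exact: measure_ge0. Qed.

Let pc_sigma_additive : semi_sigma_additive (pushforward_cancel mf mg fK).
Proof.
move=> F mF tF mUF; rewrite /pushforward_cancel /pushforward preimage_bigcup.
have mpre A : measurable A -> measurable (f @^-1` A).
  by move=> mA; rewrite -[X in measurable X]setTI; exact: mf.
apply: measure_semi_sigma_additive.
- by move=> n; exact: mpre.
- apply/trivIsetP => /= i j _ _ ij; rewrite -preimage_setI.
  by move/trivIsetP : tF => /(_ _ _ _ _ ij) ->//; rewrite preimage_set0.
- by rewrite -preimage_bigcup; exact: mpre.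
Qed.

HB.instance Definition _ := isMeasure.Build _ _ _
  (pushforward_cancel mf mg fK) pc0 pc_ge0 pc_sigma_additive.

Let sfin : sigma_finite setT (pushforward_cancel mf mg fK).
Proof.
have [F UF Foo] := sigma_finiteT m.
exists (fun k => g @^-1` F k).
  by rewrite -preimage_bigcup -UF preimage_setT.
move=> k; have [mF Fk] := Foo k; split.
  by rewrite -[X in measurable X]setTI; exact: mg.
rewrite /pushforward_cancel /pushforward -comp_preimage.
by rewrite (_ : g \o f = id) ?preimage_id//; apply/funext => x /=; rewrite fK.
Qed.

HB.instance Definition _ :=
  Measure_isSigmaFinite.Build _ _ _ (pushforward_cancel mf mg fK) sfin.

End pushforward_cancel.

(* A copy of [m1 \x m2]: the library's sigma-finite instance on the product of
   two sigma-finite measures is shadowed by the one for subprobabilities. *)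
Section product_measure.
Context d1 d2 (T1 : measurableType d1) (T2 : measurableType d2) (R : realType).
Variable m1 : {sigma_finite_measure set T1 -> \bar R}.
Variable m2 : {sigma_finite_measure set T2 -> \bar R}.

Definition product_measure : set (T1 * T2)%type -> \bar R := (m1 \x m2)%E.

HB.instance Definition _ := Measure.copy product_measure (m1 \x m2)%E.

Let product_measure_sigma_finite : sigma_finite setT product_measure.
Proof.
have /sigma_finiteP[F [TF ndF Foo]] := sigma_finiteT m1.
have /sigma_finiteP[G [TG ndG Goo]] := sigma_finiteT m2.
exists (fun n => F n `*` G n).
  rewrite -setXTT TF TG predeqE => -[x y]; split.
    move=> [/= [n _ Fnx] [k _ Gky]]; exists (maxn n k) => //; split.
    - by move: x Fnx; exact/subsetPset/ndF/leq_maxl.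
    - by move: y Gky; exact/subsetPset/ndG/leq_maxr.
  by move=> [n _ []/= ? ?]; split; exists n.
move=> k; have [? ?] := Foo k; have [? ?] := Goo k.
split; first exact: measurableX.
by rewrite [ltLHS]product_measure1E// lte_mul_pinfty// ge0_fin_numE.
Qed.

HB.instance Definition _ := Measure_isSigmaFinite.Build _ _ _
  product_measure product_measure_sigma_finite.

End product_measure.

Section lebesgue_tuple.
Variable R : realType.

Definition tcons n (p : measurableTypeR R * n.-tuple (measurableTypeR R)) : n.+1.-tuple (measurableTypeR R) :=
  [tuple of p.1 :: p.2].
Definition tuncons n (t : n.+1.-tuple (measurableTypeR R)) : measurableTypeR R * n.-tuple (measurableTypeR R) :=
  (thead t, [tuple of behead t]).

Lemma tconsK n : cancel (@tcons n) (@tuncons n).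
Proof. by move=> [x t]; congr pair; exact/val_inj. Qed.

Lemma measurable_tcons n : measurable_fun setT (@tcons n).
Proof. exact: measurable_cons. Qed.

Lemma measurable_tuncons n : measurable_fun setT (@tuncons n).
Proof.
apply: measurable_fun_pair; last exact: measurable_behead.
exact: (measurable_tnth ord0).
Qed.

Definition tuple_product n
    (m1 : {sigma_finite_measure set (measurableTypeR R) -> \bar R})
    (m2 : {sigma_finite_measure set (n.-tuple (measurableTypeR R)) -> \bar R}) :
    {sigma_finite_measure set (n.+1.-tuple (measurableTypeR R)) -> \bar R} :=
  pushforward_cancel (product_measure m1 m2)
    (@measurable_tcons n) (@measurable_tuncons n) (@tconsK n).

Fixpoint lebesgue_tuple n :
    {sigma_finite_measure set (n.-tuple (measurableTypeR R)) -> \bar R} :=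
  match n with
  | 0 => \d_ [tuple]
  | n'.+1 => tuple_product lebesgue_measure (lebesgue_tuple n')
  end.

Lemma lebesgue_tupleX n (A : 'I_n -> set (measurableTypeR R)) :
  (forall i, measurable (A i)) ->
  lebesgue_tuple n [set t | forall i, A i (tnth t i)] =
  (\prod_(i < n) lebesgue_measure (A i))%E.
Proof.
elim: n A => [|n IH] A mA.
  by rewrite big_ord0 /= diracE mem_set// => -[].
have mB : measurable
    [set t : n.-tuple (measurableTypeR R) | forall i, A (lift ord0 i) (tnth t i)].
  rewrite (_ : [set t | _] = \bigcap_(i in [set: 'I_n])
      ((@tnth n (measurableTypeR R))^~ i @^-1` A (lift ord0 i))); last first.
    by apply/seteqP; split=> [t At i _|t At i]; [exact: At|exact: At].
  apply: fin_bigcap_measurable => // i _; rewrite -[X in measurable X]setTI.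
  exact: measurable_tnth.
rewrite big_ord_recl -IH// -product_measure1E//=; congr product_measure.
apply/seteqP; split => [[x t]/= H|[x t]/= [Hx Ht] i].
  by split=> [|i]; [exact: (H ord0)|have := H (lift ord0 i); rewrite tnthS].
by case: (unliftP ord0 i) => [j|] ->//; rewrite tnthS; exact: Ht.
Qed.

End lebesgue_tuple.

Section lebesgue_rV.
Variables (R : realType) (n : nat).

Definition tuple_of_row (u : 'rV[R]_n) : n.-tuple (measurableTypeR R) :=
  [tuple u ord0 i | i < n].
Definition row_of_tuple (t : n.-tuple (measurableTypeR R)) : 'rV[R]_n :=
  \row_i tnth t i.

Lemma row_of_tupleK : cancel row_of_tuple tuple_of_row.
Proof. by move=> t; apply: eq_from_tnth => i; rewrite tnth_mktuple mxE. Qed.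

(* The sigma-algebra on R^n is the one generated by the coordinates. *)
HB.instance Definition _ := Measurable.copy 'rV[R]_n
  (g_sigma_algebra_preimageType tuple_of_row).

Lemma measurable_tuple_of_row : measurable_fun setT tuple_of_row.
Proof. by move=> _ A mA; exists A. Qed.

Lemma measurable_row_of_tuple : measurable_fun setT row_of_tuple.
Proof.
move=> _ _ [B mB <-]; rewrite !setTI -comp_preimage.
rewrite (_ : tuple_of_row \o row_of_tuple = id) ?preimage_id//.
by apply/funext => t /=; rewrite row_of_tupleK.
Qed.

Definition lebesgue_rV : {sigma_finite_measure set 'rV[R]_n -> \bar R} :=
  pushforward_cancel (lebesgue_tuple R n)
    measurable_row_of_tuple measurable_tuple_of_row row_of_tupleK.

Lemma lebesgue_rV_box (a b : 'rV[R]_n) : (forall i, a ord0 i <= b ord0 i) ->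
  lebesgue_rV [set x : 'rV[R]_n | forall i, a ord0 i < x ord0 i < b ord0 i] =
  (\prod_(i < n) (b ord0 i - a ord0 i))%:E.
Proof.
move=> ab; transitivity
    (lebesgue_tuple R n [set t | forall i, `]a ord0 i, b ord0 i[%classic (tnth t i)]).
  apply: (congr1 (lebesgue_tuple R n)); apply/seteqP.
  by split=> t /= + i => /(_ i); rewrite mxE in_itv.
rewrite (@lebesgue_tupleX R n (fun i => `]a ord0 i, b ord0 i[%classic))//.
rewrite -prodEFin; apply: eq_bigr => i _.
by rewrite lebesgue_measure_itv/= lte_fin; case: ltgtP (ab i) => // ->; rewrite subrr.
Qed.

End lebesgue_rV.
Arguments lebesgue_rV {R n}.

Section domains.
Variables (R : realType) (d : nat).
Implicit Types (Omega : set 'rV[R]_d) (u : 'rV[R]_d -> R).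

Definition bounded_domain Omega :=
  [/\ open Omega, connected Omega, Omega !=set0 & bounded_set Omega].

Definition dotv (v w : 'rV[R]_d) : R := \sum_(i < d) v ord0 i * w ord0 i.

(* [nu] is the outward unit normal at [x]: seen from [x], every direction making
   an obtuse angle with [nu] enters Omega and every direction making an acute
   angle with [nu] leaves its closure.  There is at most one such vector, and
   none at a corner of a box, where no Neumann condition is imposed. *)
Definition outward_normal Omega (x nu : 'rV[R]_d) :=
  dotv nu nu = 1 /\
  forall w, (dotv w nu < 0 -> \forall t \near 0^'+, Omega (x + t *: w)) /\
            (0 < dotv w nu ->
              \forall t \near 0^'+, ~ closure Omega (x + t *: w)).

(* Functions are total on R^d; their values outside the closure of Omega are
   irrelevant, and the normal derivative is taken from inside Omega. *)
Definition neumann Omega u :=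
  [/\ {within closure Omega, continuous u},
      forall x, Omega x -> differentiable u x &
      forall x nu, (closure Omega `\` Omega) x -> outward_normal Omega x nu ->
        (fun t => (u x - u (x - t *: nu)) / t) @ 0^'+ --> (0 : R)].

Definition open_box (a b : 'rV[R]_d) : set 'rV[R]_d :=
  [set x | forall i, a ord0 i < x ord0 i < b ord0 i].

(* [u] is identified with its periodic extension to R^d; differentiability of
   the extension makes values and gradients match on opposite faces. *)
Definition periodic (a b : 'rV[R]_d) u :=
  (forall x, differentiable u x) /\
  (forall x i, u (x + (b ord0 i - a ord0 i) *: delta_mx ord0 i) = u x).

(* Either all functions of [V] are periodic, Omega being the periodic cell, or
   all of them satisfy homogeneous Neumann conditions. *)
Definition boundary_conditions Omega (V : set ('rV[R]_d -> R)) :=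
  (exists a b, Omega = open_box a b /\ V `<=` periodic a b) \/
  V `<=` neumann Omega.

End domains.

Section L2.
Variables (R : realType) (d : nat) (Omega : set 'rV[R]_d).
Implicit Types (u v : 'rV[R]_d -> R) (D : set ('rV[R]_d -> R)).
Implicit Types A : ('rV[R]_d -> R) -> ('rV[R]_d -> R).

Definition L2 : set ('rV[R]_d -> R) :=
  [set u : 'rV[R]_d -> R | measurable_fun Omega u /\
  lebesgue_rV.-integrable Omega (fun x => (u x ^+ 2)%:E)].

Definition inner u v : R := \int[lebesgue_rV]_(x in Omega) (u x * v x).

(* An operator [A] in L^2(Omega) with domain [D], as for an unbounded operator;
   its values are only relevant on Omega. *)
Definition operator_on D A := forall u, D u -> L2 u /\ L2 (A u).

Definition linear_subspace D :=
  D (fun=> 0) /\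
  forall (c : R) u v, D u -> D v -> D (fun x => c * u x + v x).

Definition linear_on D A :=
  linear_subspace D /\
  forall (c : R) u v, D u -> D v -> forall x, Omega x ->
    A (fun y => c * u y + v y) x = c * A u x + A v x.

(* Formal self-adjointness: nothing is required of the domain of the adjoint. *)
Definition self_adjoint_on D A :=
  forall u v, D u -> D v -> inner (A u) v = inner u (A v).

Definition positive_on D A := forall u, D u -> 0 <= inner (A u) u.

(* [dF] is the L^2 gradient of the functional [u |-> \int_Omega F(u)], where
   [F u] is the energy density of [u].  [DF] is the set of functions at which
   the density makes sense (it may be proper, as for logarithmic potentials),
   and [V] is the space of admissible variations. *)
Definition variational_derivative (V DF : set ('rV[R]_d -> R))
    (F dF : ('rV[R]_d -> R) -> ('rV[R]_d -> R)) :=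
  forall u, DF u ->
    [/\ lebesgue_rV.-integrable Omega (EFin \o F u), L2 (dF u) &
        forall v, V v ->
          (\forall e \near (0 : R), DF (fun x => u x + e * v x)) /\
          is_derive (0 : R) (1 : R)
            (fun e => \int[lebesgue_rV]_(x in Omega)
                         F (fun y => u y + e * v y) x)
            (inner (dF u) v)].

End L2.

Section scalars.
Variable R : realType.

(* [Ginv] inverts [G] on [B], by surjectivity, and is arbitrary elsewhere. *)
Definition invertible_on (A B : set R) (G Ginv : R -> R) :=
  set_bij A B G /\ {in A, cancel G Ginv}.

End scalars.

Section energy.
Variables (R : realType) (d : nat) (Omega : set 'rV[R]_d).

Definition modified_energy (L : ('rV[R]_d -> R) -> ('rV[R]_d -> R))
    (Ginv : R -> R) (phi : 'rV[R]_d -> R) (r : R) : R :=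
  \int[lebesgue_rV]_(x in Omega) (2^-1 * (L phi x * phi x)) + Ginv r.

End energy.

(* Main.v *)
(* Put w = phi1 - phi0.  Testing the first equation with mu1 and the second with
   w gives (L phi1, w) + (r1 / G(intF)) (dF phi0, w) = - dt (Gop mu1, mu1), and
   the third equation says that the second summand is Ginv r1 - Ginv r0.  Since
   L is self-adjoint, 2 (L phi1, w) is the increment of (L phi, phi) plus
   (L w, w), and the latter is nonnegative. *)
Require Import Defs.
From HB Require Import structures.
From mathcomp Require Import all_boot all_order all_algebra.
From mathcomp Require Import all_classical all_reals all_analysis.
From mathcomp Require Import measurable_realfun ring lra.
Set Implicit Arguments.
Unset Strict Implicit.
Unset Printing Implicit Defensive.
Import Order.TTheory GRing.Theory Num.Theory.
Import numFieldNormedType.Exports.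
Local Open Scope classical_set_scope.
Local Open Scope ring_scope.

Section borel_rV.
Variables (R : realType) (d : nat).

Lemma measurable_coord (i : 'I_d) :
  measurable_fun setT (fun u : 'rV[R]_d => u ord0 i : measurableTypeR R).
Proof.
rewrite (_ : (fun u => _) = (@tnth d (measurableTypeR R))^~ i \o @tuple_of_row R d).
  by apply: measurableT_comp; [exact: measurable_tnth|exact: measurable_tuple_of_row].
by apply/funext => u /=; rewrite tnth_mktuple.
Qed.

Lemma measurable_open_box (a b : 'rV[R]_d) : measurable (open_box a b).
Proof.
rewrite (_ : open_box a b = \bigcap_(i in [set: 'I_d])
    ((fun u : 'rV[R]_d => u ord0 i) @^-1` `]a ord0 i, b ord0 i[%classic)).
  apply: fin_bigcap_measurable => // i _; rewrite -[X in measurable X]setTI.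
  exact: measurable_coord.
apply/seteqP; split => [u H i _|u H i] /=; first by rewrite in_itv/= H.
by have := H i I; rewrite /= in_itv.
Qed.

(** The sigma-algebra is generated by the coordinates, not by the topology. The link is that [U] is
    the union of the boxes with rational corners that it contains, and there are countably many of
    these. *)
Lemma open_measurable_rV (U : set 'rV[R]_d) : open U -> measurable U.
Proof.
move=> oU.
pose rbox (p : 'rV[rat]_d * 'rV[rat]_d) : set 'rV[R]_d :=
  open_box (map_mx ratr p.1) (map_mx ratr p.2).
(* Replacing the boxes that leave [U] by the empty set lets the union range over a whole countable
   type. *)
pose B p := if `[< rbox p `<=` U >] then rbox p else set0.
rewrite (_ : U = \bigcup_p B p); last first.
  apply/seteqP; split => [x Ux|x [p _]]; last first.
    by rewrite /B; case: asboolP => // BU; exact: BU.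
  have /nbhs_ballP[e e0 eU] : nbhs x U by exact: open_nbhs_nbhs.
  have e0' : 0 < e by [].
  have /fin_all_exists[a aP] (i : 'I_d) :
      exists q : rat, ratr q \in `]x ord0 i - e, x ord0 i[.
    by apply: rat_in_itvoo; lra.
  have /fin_all_exists[b bP] (i : 'I_d) :
      exists q : rat, ratr q \in `]x ord0 i, x ord0 i + e[.
    by apply: rat_in_itvoo; lra.
  exists (\row_i a i, \row_i b i) => //; rewrite /B asboolT.
    move=> i; rewrite !mxE; move: (aP i) (bP i).
    by rewrite !in_itv/= => /andP[_ ->] /andP[].
  (* Balls of row vectors are entrywise, so it suffices that each side of the box lies within [e] of
     the corresponding coordinate of [x]. *)
  move=> y yab; apply: eU; split => // j i; rewrite (ord1 j).
  move: (aP i) (bP i) (yab i); rewrite !in_itv/= !mxE.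
  move=> /andP[a1 a2] /andP[b1 b2] /andP[y1 y2].
  by rewrite -ball_normE/= ltr_norml; lra.
apply: countable_bigcupT_measurable; first exact: countableP.
by move=> p; rewrite /B; case: ifP => // _; exact: measurable_open_box.
Qed.

End borel_rV.

Section inner_theory.
Variables (R : realType) (d : nat) (Omega : set 'rV[R]_d).
Hypothesis mOmega : measurable Omega.
Implicit Types u v w : 'rV[R]_d -> R.

(** The product is dominated by an integrable function: [|u v| <= u^2 + v^2]. *)
Lemma L2_integrableM u v : L2 Omega u -> L2 Omega v ->
  lebesgue_rV.-integrable Omega (EFin \o (fun x => u x * v x)).
Proof.
move=> [mu iu] [mv iv]; have iuv := integrableD mOmega iu iv.
apply: le_integrable iuv => //.
  by apply/measurable_EFinP; exact: measurable_funM.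
move=> x _; rewrite /= lee_fin [leRHS]ger0_norm ?addr_ge0 ?sqr_ge0//.
by rewrite ler_norml; apply/andP; split; nra.
Qed.

(** The scheme and [linear_on] give equalities on [Omega] only; this carries them into inner
    products. *)
Lemma eq_inner u u' v v' :
  (forall x, Omega x -> u x = u' x) -> (forall x, Omega x -> v x = v' x) ->
  inner Omega u v = inner Omega u' v'.
Proof.
by move=> uu' vv'; apply: eq_Rintegral => x /set_mem Ox; rewrite uu' ?vv'.
Qed.

Lemma innerC u v : inner Omega u v = inner Omega v u.
Proof. by apply: eq_Rintegral => x _; rewrite mulrC. Qed.

Lemma innerZl c u v : L2 Omega u -> L2 Omega v ->
  inner Omega (fun x => c * u x) v = c * inner Omega u v.
Proof.
move=> Lu Lv; rewrite /inner -RintegralZl//; last exact: L2_integrableM.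
by apply: eq_Rintegral => x _; rewrite mulrA.
Qed.

Lemma inner_linearl c u v w : L2 Omega u -> L2 Omega v -> L2 Omega w ->
  inner Omega (fun x => c * u x + v x) w =
  c * inner Omega u w + inner Omega v w.
Proof.
move=> Lu Lv Lw; rewrite -innerZl// /inner -RintegralD//.
- by apply: eq_Rintegral => x _; rewrite mulrDl.
- have := integrableZl mOmega c (L2_integrableM Lu Lw).
  by apply: eq_integrable => // x _; rewrite /= -EFinM mulrA.
- exact: L2_integrableM.
Qed.

Lemma modified_energyE (L : ('rV[R]_d -> R) -> ('rV[R]_d -> R)) Ginv u r :
  L2 Omega (L u) -> L2 Omega u ->
  modified_energy Omega L Ginv u r = 2^-1 * inner Omega (L u) u + Ginv r.
Proof.
by move=> LLu Lu; rewrite /modified_energy RintegralZl//; exact: L2_integrableM.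
Qed.

(** Polarization for the symmetric form [(L u, v)]: expanding [(L w, w)] with [w = v - u], the two
    cross terms coincide by self-adjointness. The difference is written [-1 * u + v] to match the
    closure property in [linear_subspace]. *)
Lemma energy_increment D (L : ('rV[R]_d -> R) -> ('rV[R]_d -> R)) u v :
  operator_on Omega D L -> linear_on Omega D L -> self_adjoint_on Omega D L ->
  D u -> D v ->
  let w := fun x => -1 * u x + v x in
  2 * inner Omega (L v) w =
  inner Omega (L v) v - inner Omega (L u) u + inner Omega (L w) w.
Proof.
move=> opL [[_ subD] linL] saL Du Dv w.
have [[Lu LLu] [Lv LLv]] := (opL _ Du, opL _ Dv).
have [Lw _] := opL _ (subD (-1) _ _ Du Dv).
have Ew t : L2 Omega t ->
    inner Omega t w = - inner Omega t u + inner Omega t v.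
  by move=> Lt; rewrite innerC inner_linearl// mulN1r !(innerC t).
have ELw : inner Omega (L w) w = - inner Omega (L u) w + inner Omega (L v) w.
  rewrite -mulN1r -inner_linearl//.
  by apply: eq_inner => // x Ox; exact: linL.
have sa : inner Omega (L u) v = inner Omega (L v) u by rewrite saL// innerC.
by rewrite ELw !Ew// sa; ring.
Qed.

End inner_theory.

Theorem theorem2p1 (R : realType) (d : nat) (Omega : set 'rV[R]_d)
  (DL DG DF : set ('rV[R]_d -> R))
  (L Gop F dF : ('rV[R]_d -> R) -> ('rV[R]_d -> R))
  (domG codG : set R) (G Ginv : R -> R)
  (dt : R) (phi0 phi1 mu1 : 'rV[R]_d -> R) (r0 r1 : R) :
  (0 < d)%N ->
  bounded_domain Omega ->
  boundary_conditions Omega (DL `|` DG) ->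
  operator_on Omega DL L ->
  linear_on Omega DL L ->
  self_adjoint_on Omega DL L ->
  positive_on Omega DL L ->
  operator_on Omega DG Gop ->
  positive_on Omega DG Gop ->
  DF `<=` DL ->
  variational_derivative Omega DL DF F dF ->
  invertible_on domG codG G Ginv ->
  DF phi0 -> DL phi1 -> DG mu1 ->
  codG r0 -> codG r1 ->
  let intF := \int[lebesgue_rV]_(x in Omega) F phi0 x in
  domG intF ->
  G intF != 0 ->
  0 < dt ->
  (forall x, Omega x -> (phi1 x - phi0 x) / dt = - Gop mu1 x) ->
  (forall x, Omega x -> mu1 x = L phi1 x + r1 / G intF * dF phi0 x) ->
  (Ginv r1 - Ginv r0) / dt =
    r1 / G intF *
      inner Omega (dF phi0) (fun x => (phi1 x - phi0 x) / dt) ->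
  modified_energy Omega L Ginv phi1 r1 - modified_energy Omega L Ginv phi0 r0
    <= - dt * inner Omega (Gop mu1) mu1.
Proof.
move=> _ [oO _ _ _] _ opL linL saL posL opG _ DFDL vdF _ DF0 DL1 DG1 _ _ intF _ _.
move=> dt0 eq1 eq2 eq3.
have mO := open_measurable_rV oO.
have DL0 := DFDL _ DF0.
have [[[L0 LL0] [L1 LL1]] [Lmu LGmu]] := (opL _ DL0, opL _ DL1, opG _ DG1).
have [_ LdF _] := vdF _ DF0.
pose w := fun x => -1 * phi0 x + phi1 x.
have DLw : DL w by case: linL => -[_ subD] _; exact: subD.
have [Lw _] := opL _ DLw.
(* Multiplied by [dt], the first equation reads [w = - dt * Gop mu1] on [Omega]. *)
have test_mu : inner Omega mu1 w = - dt * inner Omega (Gop mu1) mu1.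
  rewrite -innerZl// innerC; apply: eq_inner => // x Ox.
  have /(congr1 ( *%R dt)) := eq1 _ Ox.
  rewrite mulrCA divff ?gt_eqF// mulr1 mulrN mulNr => <-.
  by rewrite /w mulN1r addrC.
have test_w : inner Omega mu1 w =
    r1 / G intF * inner Omega (dF phi0) w + inner Omega (L phi1) w.
  by rewrite -inner_linearl//; apply: eq_inner => // x Ox; rewrite eq2// addrC.
have sav : Ginv r1 - Ginv r0 = r1 / G intF * inner Omega (dF phi0) w.
  move: eq3; rewrite (_ : inner _ _ _ = dt^-1 * inner Omega (dF phi0) w); last first.
    rewrite innerC [in RHS]innerC -innerZl//; apply: eq_inner => // x _.
    by rewrite /w; ring.
  (* Both sides now carry a factor [dt^-1], which cancels because [dt] is positive. *)
  by rewrite mulrA mulrAC => /mulIf; apply; rewrite invr_eq0 gt_eqF.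
have incr := energy_increment mO opL linL saL DL0 DL1.
rewrite /= -/w in incr; have Lw_ge0 := posL _ DLw.
(* The right-hand side becomes [Ginv r1 - Ginv r0 + (L phi1, w)]; by [incr] it exceeds the energy
   increment by exactly half of [(L w, w)]. *)
by rewrite !modified_energyE// -test_mu test_w -sav; lra.
Qed.
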